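(* Let $k$ be a field, $A\,|\,B$ an extension of $k$-algebras, $M$ a left $A$-module, and $\mathcal{E}=\mathrm{End}({}_BM)$. If $A\,|\,B$ is left depth two, then there is a ring isomorphism $$\Psi: T\ltimes \mathcal{E}\ \stackrel{\cong}{\longrightarrow}\ \mathrm{End}({}_A A\otimes_B M),\qquad \Psi(t\otimes f)(a\otimes m)=a t^1\otimes_B t^2 f(m)$$ for $t\in T$, $f\in\mathcal{E}$, $a\in A$, $m\in M$, where $T=(A\otimes_B A)^B$ and $T\ltimes\mathcal{E}$ is the smash product ring.
   Context: An algebra extension $A\,|\,B$ is a unital homomorphism $B\to A$ of unital associative algebras. It is left depth two if for some positive integer $n$ the natural $B$-$A$-bimodule $A\otimes_B A$ is isomorphic to a direct summand of $A^n$ as $B$-$A$-bimodules. Let $R=C_A(B)=\{r\in A: rb=br\ \forall b\in B\}$ and $T=(A\otimes_B A)^B=\{t\in A\otimes_B A : bt=tb\ \forall b\in B\}$. Write $t=t^1\otimes_B t^2$, suppressing a possible summation. $T$ is a ring with product $uv=v^1u^1\otimes_B u^2v^2$ and unit $1_T=1_A\otimes_B 1_A$. It is an $R$-$R$-bimodule via $s\cdot t\cdot r=st^1\otimes_B t^2r$. Let $S=\mathrm{End}({}_BA_B)$. For a left depth two extension there are finitely many $\beta_i\in S$, $t_i\in T$ (a left D2 quasibase) with $x\otimes_B y=\sum_i t_i\beta_i(x)y$ for all $x,y\in A$. The coproduct $\Delta:T\to T\otimes_R T$, $\Delta(u)=u_{(1)}\otimes u_{(2)}$, is $\Delta(u)=\sum_i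 t_i\otimes_R(\beta_i(u^1)\otimes_B u^2)$. It is independent of the choice of quasibase. $\mathcal{E}=\mathrm{End}({}_BM)$ is the ring of endomorphisms of $M$ restricted to a left $B$-module, under composition. It is a left $R$-module by $(r\cdot f)(m)=r f(m)$. $T$ acts on $\mathcal{E}$ from the right by $(f\triangleleft t)(m)=t^1f(t^2m)$. The smash product ring $T\ltimes\mathcal{E}$ is $T\otimes_R\mathcal{E}$ with multiplication $$(t\otimes f)(u\otimes g)=t\,u_{(1)}\otimes (f\triangleleft u_{(2)})\circ g$$ and unit $1_T\otimes\mathrm{id}_M$. $\mathrm{End}({}_AA\otimes_BM)$ is the ring of left $A$-linear endomorphisms of $A\otimes_B M$ under composition. *)

(* Defs.v *)
From HB Require Import structures.
From mathcomp Require Import all_boot all_algebra.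
From mathcomp Require Import boolp functions.
From mathcomp.multinomials Require Import freeg.

Set Implicit Arguments.
Unset Strict Implicit.
Unset Printing Implicit Defensive.

Import GRing.Theory.
Local Open Scope ring_scope.

(* The tensor product of abelian groups X and Y over a set of scalars I acting
   by ra on the right of X and by la on the left of Y: the free abelian group
   on X * Y modulo the subgroup generated by the usual relations. The actions
   are plain functions rather than module structures because A, T and M below
   carry several actions at once, and no module law is needed to form the
   quotient. *)
Section Tensor.
Variables (I : Type) (X Y : zmodType) (ra : X -> I -> X) (la : I -> Y -> Y).

Definition fpair (x : X) (y : Y) : {freeg (X * Y)%type / int} := << (x, y) >>.

Inductive tensor_rel : {freeg (X * Y)%type / int} -> Prop :=
| tensor_rel0 : tensor_rel 0
| tensor_relB g h : tensor_rel g -> tensor_rel h -> tensor_rel (g - h)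
| tensor_relDl x x' y :
    tensor_rel (fpair (x + x') y - (fpair x y + fpair x' y))
| tensor_relDr x y y' :
    tensor_rel (fpair x (y + y') - (fpair x y + fpair x y'))
| tensor_relM x i y : tensor_rel (fpair (ra x i) y - fpair x (la i y)).

Definition tensor_relb : {pred {freeg (X * Y)%type / int}} :=
  fun g => `[< tensor_rel g >].

Fact tensor_relb_closed : zmod_closed tensor_relb.
Proof.
split; first exact/asboolP/tensor_rel0.
by move=> g h /asboolP hg /asboolP hh; apply/asboolP/tensor_relB.
Qed.
HB.instance Definition _ :=
  GRing.isZmodClosed.Build _ tensor_relb tensor_relb_closed.

Definition tensor : Type := Quotient.quot tensor_relb.
HB.instance Definition _ := GRing.Zmodule.on tensor.

Definition tens (x : X) (y : Y) : tensor :=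
  (\pi_(Quotient.quot tensor_relb) (fpair x y))%qT.

Definition balanced (Z : zmodType) (f : X -> Y -> Z) : Prop :=
  [/\ forall x x' y, f (x + x') y = f x y + f x' y,
      forall x y y', f x (y + y') = f x y + f x y'
    & forall x i y, f (ra x i) y = f x (la i y)].

(* The additive map x (x) y |-> f x y if f is balanced (see tlift_tens), and 0
   otherwise; this keeps tlift f additive without a proof argument. *)
Definition tlift (Z : zmodType) (f : X -> Y -> Z) (t : tensor) : Z :=
  if `[< balanced f >] then
    fglift (fun p => f p.1 p.2 : zmodule Z) (repr (t : Quotient.quot tensor_relb))
  else 0.

Let piZ g h : tensor_rel (g - h) ->
  (\pi_(Quotient.quot tensor_relb) g = \pi_(Quotient.quot tensor_relb) h)%qT.
Proof. by move=> r; apply/eqP; rewrite -Quotient.idealrBE; apply/asboolP. Qed.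

Let relZ (g h : {freeg (X * Y)%type / int}) :
  (\pi_(Quotient.quot tensor_relb) g = \pi_(Quotient.quot tensor_relb) h)%qT ->
  tensor_rel (g - h).
Proof. by move/eqP; rewrite -Quotient.idealrBE => /asboolP. Qed.

Lemma tensDl x x' y : tens (x + x') y = tens x y + tens x' y.
Proof. by rewrite /tens -raddfD; apply: piZ; constructor. Qed.

Lemma tensDr x y y' : tens x (y + y') = tens x y + tens x y'.
Proof. by rewrite /tens -raddfD; apply: piZ; constructor. Qed.

Lemma tensM x i y : tens (ra x i) y = tens x (la i y).
Proof. by apply: piZ; constructor. Qed.

Lemma tensBl y : zmod_morphism (tens^~ y).
Proof.
by move=> x x'; apply/(addIr (tens x' y)); rewrite -tensDl !subrK.
Qed.

Lemma tensBr x : zmod_morphism (tens x).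
Proof.
by move=> y y'; apply/(addIr (tens x y')); rewrite -tensDr !subrK.
Qed.
HB.instance Definition _ x :=
  GRing.isZmodMorphism.Build Y tensor (tens x) (tensBr x).

Lemma tens_suml (J : Type) (r : seq J) (F : J -> X) y :
  tens (\sum_(j <- r) F j) y = \sum_(j <- r) tens (F j) y.
Proof.
have t0 : tens 0 y = 0 by apply: (addIr (tens 0 y)); rewrite -tensDl !add0r.
by elim/big_rec2: _ => // j x t _ <-; rewrite tensDl.
Qed.

Lemma tens_mulz x y (k : int) : tens (x *~ k) y = tens x y *~ k.
Proof.
pose F : X -> tensor := tens^~ y.
have FM := GRing.isZmodMorphism.Build X tensor F (tensBl y).
pose G : {additive X -> tensor} := HB.pack F FM.
exact: (raddfMz G).
Qed.

Lemma tensor_ind (P : tensor -> Prop) :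
  P 0 -> (forall x y, P (tens x y)) -> (forall s t, P s -> P t -> P (s + t)) ->
  forall t, P t.
Proof.
move=> P0 Pt PD t.
rewrite -[t](reprK (t : Quotient.quot tensor_relb)) -(freeg_sumE (repr _)).
rewrite raddf_sum.
apply: (big_ind P) => // -[x y] _; set k := coeff _ _.
suff e : (\pi_(Quotient.quot tensor_relb) << k *g (x, y) >>)%qT = tens (x *~ k) y.
  by rewrite -[X in P X]/(\pi_(Quotient.quot tensor_relb) << k *g (x, y) >>)%qT e.
rewrite tens_mulz /tens -raddfMz; congr (\pi_ _ _)%qT.
by rewrite /fpair freegU_mulz intz.
Qed.

Section Lift.
Variables (Z : zmodType) (f : X -> Y -> Z).
Let F (g : {freeg (X * Y)%type / int}) : Z :=
  fglift (fun p => f p.1 p.2 : zmodule Z) g.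

Let FB g h : F (g - h) = F g - F h.
Proof. exact: (@lift_is_additive _ _ (zmodule Z) (fun p => f p.1 p.2 : zmodule Z)). Qed.
Let F0 : F 0 = 0. Proof. by have := FB 0 0; rewrite !subrr. Qed.
Let FD g h : F (g + h) = F g + F h.
Proof. by apply/(addIr (- F h)); rewrite addrK -FB addrK. Qed.
Let FU x y : F (fpair x y) = f x y.
Proof. by rewrite /F /fpair liftU /= [LHS]scale1r. Qed.

Let F_rel : balanced f -> forall g, tensor_rel g -> F g = 0.
Proof.
case=> fDl fDr fM g; elim=> {g} //.
- by move=> g h _ Fg _ Fh; rewrite FB Fg Fh subrr.
- by move=> x x' y; rewrite FB FD !FU fDl subrr.
- by move=> x y y'; rewrite FB FD !FU fDr subrr.
- by move=> x i y; rewrite FB !FU fM subrr.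
Qed.

Let F_pi : balanced f -> forall g, F (repr (\pi_(Quotient.quot tensor_relb) g)%qT) = F g.
Proof.
move=> fb g; apply/eqP; rewrite -subr_eq0 -FB; apply/eqP/(F_rel fb)/relZ.
by rewrite reprK.
Qed.

Lemma tlift_tens : balanced f -> forall x y, tlift f (tens x y) = f x y.
Proof.
by move=> fb x y; rewrite /tlift asboolT // -[LHS]/(F _) F_pi ?FU.
Qed.

Lemma tliftB : zmod_morphism (tlift f).
Proof.
move=> s t; rewrite /tlift; case: asboolP => [fb|]; last by rewrite subrr.
have e : s - t = (\pi_(Quotient.quot tensor_relb)
    (repr (s : Quotient.quot tensor_relb) -
     repr (t : Quotient.quot tensor_relb)))%qT.
  rewrite -{1}[s](reprK (s : Quotient.quot tensor_relb)).
  by rewrite -{1}[t](reprK (t : Quotient.quot tensor_relb)) -raddfB.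
by rewrite -[RHS]FB -[LHS]/(F _) -[RHS](F_pi fb) -e.
Qed.
HB.instance Definition _ :=
  GRing.isZmodMorphism.Build tensor Z (tlift f) tliftB.

End Lift.

End Tensor.

(* End(_R V): the R-linear maps V -> V with composition as product. *)
Section LinearEndomorphisms.
Variables (R : pzRingType) (V : lmodType R).

Definition linearb : {pred V -> V} := fun f => `[< linear f >].

Fact linearb_closed : zmod_closed linearb.
Proof.
split.
  by apply/asboolP => a u v; rewrite scaler0 addr0.
move=> f g /asboolP fl /asboolP gl; apply/asboolP => a u v.
rewrite /= !fctE fl gl scalerBr; by rewrite opprD addrACA.
Qed.
HB.instance Definition _ := GRing.isZmodClosed.Build _ linearb linearb_closed.

Record linEnd := LinEnd { linEnd_val :> V -> V; _ : linEnd_val \in linearb }.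

HB.instance Definition _ := [isSub for linEnd_val].
HB.instance Definition _ := [Choice of linEnd by <:].
HB.instance Definition _ := [SubChoice_isSubZmodule of linEnd by <:].

Lemma linEnd_linear (f : linEnd) : linear f.
Proof. by apply/asboolP; exact: (valP f). Qed.
HB.instance Definition _ (f : linEnd) :=
  GRing.isLinear.Build R V V *:%R (linEnd_val f) (linEnd_linear f).

Lemma linEndP (f g : linEnd) : f =1 g -> f = g.
Proof. by move=> fg; apply/val_inj/funext. Qed.

Fact linEnd_one_subproof : (id : V -> V) \in linearb.
Proof. by apply/asboolP. Qed.
Definition linEnd_one : linEnd := LinEnd linEnd_one_subproof.

Fact linEnd_mul_subproof (f g : linEnd) : (f \o g) \in linearb.
Proof. by apply/asboolP => a u v /=; rewrite !linearP. Qed.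
Definition linEnd_mul (f g : linEnd) : linEnd := LinEnd (linEnd_mul_subproof f g).

Lemma linEnd_addE (f g : linEnd) v : (f + g) v = f v + g v.
Proof. by []. Qed.

Fact linEnd_mulA : associative linEnd_mul. Proof. by move=> f g h; apply: linEndP. Qed.
Fact linEnd_mul1r : left_id linEnd_one linEnd_mul. Proof. by move=> f; apply: linEndP. Qed.
Fact linEnd_mulr1 : right_id linEnd_one linEnd_mul. Proof. by move=> f; apply: linEndP. Qed.
Fact linEnd_mulDl : left_distributive linEnd_mul +%R.
Proof. by move=> f g h; apply: linEndP. Qed.
Fact linEnd_mulDr : right_distributive linEnd_mul +%R.
Proof. by move=> f g h; apply: linEndP => v; exact: linearD. Qed.
HB.instance Definition _ := GRing.Zmodule_isPzRing.Build linEnd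
  linEnd_mulA linEnd_mul1r linEnd_mulr1 linEnd_mulDl linEnd_mulDr.

Lemma linEnd_mulE (f g : linEnd) v : (f * g) v = f (g v).
Proof. by []. Qed.
Lemma linEnd_oneE v : (1 : linEnd) v = v.
Proof. by []. Qed.
Lemma linEnd_sumE (J : Type) (r : seq J) (F : J -> linEnd) v :
  (\sum_(j <- r) F j) v = \sum_(j <- r) F j v.
Proof. by elim/big_rec2: _ => // j y g _ <-. Qed.

End LinearEndomorphisms.

(* MathComp's algType excludes the zero ring, so a k-algebra is taken to be a
   pzRingType with a central ring morphism from k. *)
Definition central (k A : pzRingType) (eta : {rmorphism k -> A}) : Prop :=
  forall c a, eta c * a = a * eta c.

(* The extension A | B; phi need not be injective. *)
Section Extension.
Variables (A B : pzRingType) (phi : {rmorphism B -> A}).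

(* M with the left B-action through phi. *)
Definition restr (M : lmodType A) : Type := M.
HB.instance Definition _ (M : lmodType A) := GRing.Zmodule.on (restr M).

Section Restriction.
Variable M : lmodType A.
Definition restr_scale (b : B) (m : restr M) : restr M := phi b *: (m : M).
Fact restr_scaleA a b m : restr_scale a (restr_scale b m) = restr_scale (a * b) m.
Proof. by rewrite /restr_scale scalerA rmorphM. Qed.
Fact restr_scale1 : left_id 1 restr_scale.
Proof. by move=> m; rewrite /restr_scale rmorph1 scale1r. Qed.
Fact restr_scaleDr : right_distributive restr_scale +%R.
Proof. by move=> b m n; rewrite /restr_scale scalerDr. Qed.
Fact restr_scaleDl m : {morph restr_scale^~ m : a b / a + b}.
Proof. by move=> a b; rewrite /restr_scale rmorphD scalerDl. Qed.
HB.instance Definition _ := GRing.Zmodule_isLmodule.Build B (restr M)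
  restr_scaleA restr_scale1 restr_scaleDr restr_scaleDl.
End Restriction.

Section TensorB.
Variable M : lmodType A.

(* A (x)_B M, with its left A-action. *)
Definition tensB : Type :=
  tensor (fun (a : A) (b : B) => a * phi b)
         (fun (b : B) (m : restr M) => b *: m).
HB.instance Definition _ := GRing.Zmodule.on tensB.

Definition btens (a : A) (m : M) : tensB := tens _ _ a (m : restr M).

Definition blift (Z : zmodType) (f : A -> M -> Z) (t : tensB) : Z := tlift f t.
HB.instance Definition _ (Z : zmodType) (f : A -> M -> Z) :=
  GRing.Additive.copy (blift f) (tlift f : tensB -> Z).

Lemma btensM a b m : btens (a * phi b) m = btens a (phi b *: m).
Proof. exact: tensM. Qed.
Lemma btensDl a a' m : btens (a + a') m = btens a m + btens a' m.
Proof. exact: tensDl. Qed.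
Lemma btensDr a m m' : btens a (m + m') = btens a m + btens a m'.
Proof. exact: tensDr. Qed.

Lemma tensB_ind (P : tensB -> Prop) :
  P 0 -> (forall x y, P (btens x y)) -> (forall s t, P s -> P t -> P (s + t)) ->
  forall t, P t.
Proof. exact: tensor_ind. Qed.

Definition bbalanced (Z : zmodType) (f : A -> M -> Z) : Prop :=
  [/\ forall x x' y, f (x + x') y = f x y + f x' y,
      forall x y y', f x (y + y') = f x y + f x y'
    & forall x b y, f (x * phi b) y = f x (phi b *: y)].

Lemma blift_btens (Z : zmodType) (f : A -> M -> Z) :
  bbalanced f -> forall x y, blift f (btens x y) = f x y.
Proof. by move=> fb x y; exact: (@tlift_tens B A (restr M) _ _ Z f fb x y). Qed.

Definition tensB_scale (a : A) (t : tensB) : tensB :=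
  blift (fun x m => btens (a * x) m) t.

Lemma tensB_scaleE a x m : tensB_scale a (btens x m) = btens (a * x) m.
Proof.
apply: (blift_btens (f := fun x m => btens (a * x) m)); split=> *.
- by rewrite mulrDr btensDl.
- by rewrite btensDr.
- by rewrite mulrA btensM.
Qed.

Fact tensB_scaleA a b t : tensB_scale a (tensB_scale b t) = tensB_scale (a * b) t.
Proof.
elim/tensB_ind: t => [|x m|s t hs ht]; first by rewrite /tensB_scale !raddf0.
  by rewrite !tensB_scaleE mulrA.
by move: hs ht; rewrite /tensB_scale !raddfD /= => -> ->.
Qed.
Fact tensB_scale1 : left_id 1 tensB_scale.
Proof.
elim/tensB_ind => [|x m|s t hs ht]; first by rewrite /tensB_scale !raddf0.
  by rewrite !tensB_scaleE mul1r.
by move: hs ht; rewrite /tensB_scale !raddfD /= => -> ->.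
Qed.
Fact tensB_scaleDr : right_distributive tensB_scale +%R.
Proof. by move=> a s t; rewrite /tensB_scale raddfD. Qed.
Fact tensB_scaleDl t : {morph tensB_scale^~ t : a b / a + b}.
Proof.
move=> a b; elim/tensB_ind: t => [|x m|s t hs ht].
- by rewrite /tensB_scale !raddf0 addr0.
- by rewrite !tensB_scaleE mulrDl btensDl.
- by move: hs ht; rewrite /tensB_scale !raddfD /= => -> ->; rewrite addrACA.
Qed.
HB.instance Definition _ := GRing.Zmodule_isLmodule.Build A tensB
  tensB_scaleA tensB_scale1 tensB_scaleDr tensB_scaleDl.

Lemma scale_btens a x m : a *: btens x m = btens (a * x) m.
Proof. exact: tensB_scaleE. Qed.

End TensorB.

Definition AA : Type := tensB A^o.
HB.instance Definition _ := GRing.Lmodule.on AA.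

Definition aatens (x y : A) : AA := btens x (y : A^o).

Definition aalift (Z : zmodType) (f : A -> A -> Z) (t : AA) : Z :=
  blift (f : A -> A^o -> Z) t.
HB.instance Definition _ (Z : zmodType) (f : A -> A -> Z) :=
  GRing.Additive.copy (aalift f) (@blift A^o Z f : AA -> Z).

Lemma aatensDl a a' m : aatens (a + a') m = aatens a m + aatens a' m.
Proof. exact: btensDl. Qed.
Lemma aatensDr a m m' : aatens a (m + m') = aatens a m + aatens a m'.
Proof. exact: btensDr. Qed.
Lemma aatensM a b m : aatens (a * phi b) m = aatens a (phi b * m).
Proof. exact: btensM. Qed.
Lemma scale_aatens a x y : a *: aatens x y = aatens (a * x) y.
Proof. exact: scale_btens. Qed.
Lemma AA_ind (P : AA -> Prop) :
  P 0 -> (forall x y, P (aatens x y)) -> (forall s t, P s -> P t -> P (s + t)) ->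
  forall t, P t.
Proof. exact: (@tensB_ind A^o P). Qed.

Definition aabalanced (Z : zmodType) (f : A -> A -> Z) : Prop :=
  [/\ forall x x' y, f (x + x') y = f x y + f x' y,
      forall x y y', f x (y + y') = f x y + f x y'
    & forall x b y, f (x * phi b) y = f x (phi b * y)].

Lemma aalift_aatens (Z : zmodType) (f : A -> A -> Z) :
  aabalanced f -> forall x y, aalift f (aatens x y) = f x y.
Proof. by move=> fb x y; exact: (@blift_btens A^o Z f fb x y). Qed.

(* The right A-action on A (x)_B A; the left one is scaling. *)
Definition ract (t : AA) (a : A) : AA := aalift (fun x y => aatens x (y * a)) t.

Lemma ract_aatens x y a : ract (aatens x y) a = aatens x (y * a).
Proof.
apply: (aalift_aatens (f := fun x y => aatens x (y * a))); split=> *.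
- by rewrite aatensDl.
- by rewrite mulrDl aatensDr.
- by rewrite -mulrA aatensM.
Qed.
Lemma ract0 a : ract 0 a = 0. Proof. exact: raddf0. Qed.
Lemma ractDl s t a : ract (s + t) a = ract s a + ract t a.
Proof. exact: raddfD. Qed.
Lemma ractBl s t a : ract (s - t) a = ract s a - ract t a.
Proof. exact: raddfB. Qed.
Lemma ract_suml (J : Type) (r : seq J) (F : J -> AA) a :
  ract (\sum_(j <- r) F j) a = \sum_(j <- r) ract (F j) a.
Proof. exact: raddf_sum. Qed.
Lemma ractDr t a b : ract t (a + b) = ract t a + ract t b.
Proof.
elim/AA_ind: t => [|x y|s t hs ht]; first by rewrite !ract0 addr0.
  by rewrite !ract_aatens mulrDr aatensDr.
by rewrite !ractDl hs ht addrACA.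
Qed.
Lemma ractA t a b : ract (ract t a) b = ract t (a * b).
Proof.
elim/AA_ind: t => [|x y|s t hs ht]; first by rewrite !ract0.
  by rewrite !ract_aatens mulrA.
by rewrite !ractDl hs ht.
Qed.
Lemma ract1 t : ract t 1 = t.
Proof.
elim/AA_ind: t => [|x y|s t hs ht]; first by rewrite !ract0.
  by rewrite !ract_aatens mulr1.
by rewrite !ractDl hs ht.
Qed.
Lemma ract_scale a t c : ract (a *: t) c = a *: ract t c.
Proof.
elim/AA_ind: t => [|x y|s t hs ht]; first by rewrite scaler0 !ract0 scaler0.
  by rewrite scale_aatens !ract_aatens scale_aatens.
by rewrite scalerDr !ractDl scalerDr hs ht.
Qed.

(* A^n is 'rV[A]_n: scaling is the left action, row_ract the right one. *)
Definition row_ract (n : nat) (v : 'rV[A]_n) (a : A) : 'rV[A]_n :=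
  \row_j (v 0 j * a).

Definition sub_bimodule (n : nat) (P : 'rV[A]_n -> Prop) : Prop :=
  [/\ P 0, forall u v, P u -> P v -> P (u - v),
      forall b v, P v -> P (phi b *: v)
    & forall v a, P v -> P (row_ract v a)].

(* h is an isomorphism of B-A-bimodules from A (x)_B A onto the summand P of
   A^n = P (+) Q. *)
Definition left_depth_two : Prop :=
  exists n : nat, (0 < n)%N /\
  exists P Q : 'rV[A]_n -> Prop,
  [/\ sub_bimodule P, sub_bimodule Q,
      (forall v, exists p q, [/\ P p, Q q & v = p + q]),
      (forall v, P v -> Q v -> v = 0)
    & exists h : {additive AA -> 'rV[A]_n},
      [/\ forall b t, h (phi b *: t) = phi b *: h t,
          forall t a, h (ract t a) = row_ract (h t) a,
          injective h & forall v, P v <-> exists t, h t = v]].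

(* R = C_A(B) *)
Record centr := Centr {
  centr_val :> A;
  centrP : forall b, centr_val * phi b = phi b * centr_val }.

(* T = (A (x)_B A)^B *)
Definition invb : {pred AA} := fun t => `[< forall b, phi b *: t = ract t (phi b) >].

Fact invb_closed : zmod_closed invb.
Proof.
split; first by apply/asboolP => b; rewrite scaler0 ract0.
move=> s t /asboolP hs /asboolP ht; apply/asboolP => b.
by rewrite scalerBr hs ht ractBl.
Qed.
HB.instance Definition _ := GRing.isZmodClosed.Build _ invb invb_closed.

Record Tring := MkT { T_val :> AA; _ : T_val \in invb }.
HB.instance Definition _ := [isSub for T_val].
HB.instance Definition _ := [Choice of Tring by <:].
HB.instance Definition _ := [SubChoice_isSubZmodule of Tring by <:].

Lemma T_inv (t : Tring) b : phi b *: (t : AA) = ract t (phi b).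
Proof. by move: b; apply/asboolP; exact: (valP t). Qed.
Lemma T_addE (s t : Tring) : T_val (s + t) = T_val s + T_val t.
Proof. by []. Qed.
Lemma T_inj (s t : Tring) : (s : AA) = t -> s = t.
Proof. exact: val_inj. Qed.

(* v^1 u^1 (x) u^2 v^2, which is balanced in v when u is in T. *)
Definition T_sand (u : AA) (v : AA) : AA := aalift (fun x y => x *: ract u y) v.
HB.instance Definition _ (u : AA) := GRing.Additive.copy (T_sand u)
  (aalift (fun x y => x *: ract u y)).

Lemma T_sandE (u : Tring) x y : T_sand u (aatens x y) = x *: ract u y.
Proof.
apply: (aalift_aatens (f := fun x y => x *: ract u y)); split=> *.
- by rewrite scalerDl.
- by rewrite ractDr scalerDr.
- by rewrite -scalerA -ract_scale T_inv ractA.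
Qed.
Lemma T_sand_scale (u : Tring) a v : T_sand u (a *: v) = a *: T_sand u v.
Proof.
elim/AA_ind: v => [|x y|s t hs ht]; first by rewrite !(scaler0, raddf0).
  by rewrite scale_aatens !T_sandE scalerA.
by rewrite scalerDr !raddfD /= hs ht.
Qed.
Lemma T_sand_ract (u : Tring) v a : T_sand u (ract v a) = ract (T_sand u v) a.
Proof.
elim/AA_ind: v => [|x y|s t hs ht]; first by rewrite !(ract0, raddf0).
  by rewrite ract_aatens !T_sandE ract_scale ractA.
by rewrite ractDl !raddfD /= ractDl hs ht.
Qed.

Fact T_mul_subproof (u v : Tring) : T_sand u v \in invb.
Proof. by apply/asboolP => b; rewrite -T_sand_scale T_inv T_sand_ract. Qed.
Definition T_mul (u v : Tring) : Tring := MkT (T_mul_subproof u v).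

Fact T_one_subproof : aatens 1 1 \in invb.
Proof.
apply/asboolP => b; rewrite scale_aatens ract_aatens mulr1 mul1r.
by rewrite -[phi b in LHS]mul1r aatensM mulr1.
Qed.
Definition T_one : Tring := MkT T_one_subproof.

Fact T_mulA : associative T_mul.
Proof.
move=> u v w; apply: T_inj => /=; elim/AA_ind: (w : AA) => [|x y|s t hs ht].
- by rewrite !raddf0.
- rewrite (T_sandE v) T_sand_scale T_sand_ract.
  by rewrite (T_sandE (T_mul u v)).
- by rewrite !raddfD /= hs ht.
Qed.
Fact T_mul1 : left_id T_one T_mul.
Proof.
move=> v; apply: T_inj => /=; elim/AA_ind: (v : AA) => [|x y|s t hs ht].
- by rewrite !raddf0.
- by rewrite (T_sandE T_one) ract_aatens scale_aatens mulr1 mul1r.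
- by rewrite !raddfD /= hs ht.
Qed.
Fact T_mulr1 : right_id T_one T_mul.
Proof. by move=> u; apply: T_inj; rewrite /= T_sandE ract1 scale1r. Qed.
Fact T_mulDr : right_distributive T_mul +%R.
Proof. by move=> u v w; apply: T_inj; exact: (raddfD (T_sand u)). Qed.
Fact T_mulDl : left_distributive T_mul +%R.
Proof.
move=> u v w; apply: T_inj.
change (T_sand (u + v : Tring) w = T_sand u w + T_sand v w).
elim/AA_ind: (w : AA) => [|x y|s t hs ht]; first by rewrite !raddf0 addr0.
  by rewrite !T_sandE T_addE ractDl scalerDr.
by rewrite !raddfD /= hs ht addrACA.
Qed.
HB.instance Definition _ := GRing.Zmodule_isPzRing.Build Tring
  T_mulA T_mul1 T_mulr1 T_mulDl T_mulDr.

Lemma T_mulE (u v : Tring) : (u * v : Tring) = T_sand u v :> AA.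
Proof. by []. Qed.
Lemma T_oneE : (1 : Tring) = aatens 1 1 :> AA.
Proof. by []. Qed.

Fact T_lact_subproof (r : centr) (t : Tring) : (r : A) *: (t : AA) \in invb.
Proof.
apply/asboolP => b; rewrite ract_scale -T_inv !scalerA.
by rewrite centrP.
Qed.
Definition T_lact (r : centr) (t : Tring) : Tring := MkT (T_lact_subproof r t).

Fact T_ract_subproof (t : Tring) (r : centr) : ract t r \in invb.
Proof. by apply/asboolP => b; rewrite -ract_scale T_inv !ractA centrP. Qed.
Definition T_ract (t : Tring) (r : centr) : Tring := MkT (T_ract_subproof t r).

(* S = End(_B A_B) *)
Record bimodEnd := BimodEnd {
  S_val :> {additive A -> A};
  S_bl : forall b a, S_val (phi b * a) = phi b * S_val a;
  S_br : forall a b, S_val (a * phi b) = S_val a * phi b }.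

(* s(t^1) (x) t^2, s(t^1) t^2 being S_ev below. *)
Definition S_app (s : bimodEnd) (t : AA) : AA := aalift (fun x y => aatens (s x) y) t.
HB.instance Definition _ (s : bimodEnd) := GRing.Additive.copy (S_app s)
  (aalift (fun x y => aatens (s x) y)).
Lemma S_appE (s : bimodEnd) x y : S_app s (aatens x y) = aatens (s x) y.
Proof.
apply: (aalift_aatens (f := fun x y => aatens (s x) y)); split=> *.
- by rewrite raddfD aatensDl.
- by rewrite aatensDr.
- by rewrite S_br aatensM.
Qed.
Lemma S_app_bl (s : bimodEnd) b t : S_app s (phi b *: t) = phi b *: S_app s t.
Proof.
elim/AA_ind: t => [|x y|t u ht hu]; first by rewrite !(scaler0, raddf0).
  by rewrite scale_aatens !S_appE S_bl scale_aatens.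
by rewrite scalerDr !raddfD /= ht hu.
Qed.
Lemma S_app_ract (s : bimodEnd) t a : S_app s (ract t a) = ract (S_app s t) a.
Proof.
elim/AA_ind: t => [|x y|t u ht hu]; first by rewrite !(ract0, raddf0).
  by rewrite ract_aatens !S_appE ract_aatens.
by rewrite ractDl !raddfD /= ractDl ht hu.
Qed.
Fact S_act_subproof (s : bimodEnd) (t : Tring) : S_app s t \in invb.
Proof. by apply/asboolP => b; rewrite -S_app_bl T_inv S_app_ract. Qed.
Definition S_act (s : bimodEnd) (t : Tring) : Tring := MkT (S_act_subproof s t).

Record quasibase := Quasibase {
  qb_size : nat;
  qb_beta : 'I_qb_size -> bimodEnd;
  qb_t : 'I_qb_size -> Tring;
  qbP : forall x y, aatens x y = \sum_i ract (qb_t i) (qb_beta i x * y) }.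

Arguments qb_beta : clear implicits.
Arguments qb_t : clear implicits.

Theorem left_depth_two_quasibase : left_depth_two -> exists q : quasibase, True.
Proof.
case=> n [_ [P [Q [P_sub Q_sub PQ PQ0 [h [hB hA h_inj h_im]]]]]].
have [P0 PB PZ PM] := P_sub; have [Q0 QB QZ QM] := Q_sub.
have PN v : P v -> P (- v) by move=> Pv; rewrite -sub0r; apply: PB.
have QN v : Q v -> Q (- v) by move=> Qv; rewrite -sub0r; apply: QB.
have PD u v : P u -> P v -> P (u + v).
  by move=> Pu Pv; rewrite -[v]opprK; apply: PB => //; apply: PN.
have QD u v : Q u -> Q v -> Q (u + v).
  by move=> Qu Qv; rewrite -[v]opprK; apply: QB => //; apply: QN.
have gP v : exists t, Q (v - h t).
  have [p [q [Pp Qq ->]]] := PQ v; have [t <-] := (h_im p).1 Pp.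
  by exists t; rewrite addrC addKr.
pose g v : AA := sval (cid (gP v)).
have gQ v : Q (v - h (g v)) by rewrite /g; case: cid.
have g_uniq v t : Q (v - h t) -> g v = t.
  move=> Qt; apply: h_inj; apply/eqP; rewrite -subr_eq0; apply/eqP/PQ0.
    by rewrite -raddfB; apply/h_im; exists (g v - t).
  by move: (QB _ _ Qt (gQ v)); rewrite opprB addrC addrA subrK.
have gh t : g (h t) = t by apply: g_uniq; rewrite subrr.
have gD u v : g (u + v) = g u + g v.
  by apply: g_uniq; rewrite raddfD /= opprD addrACA; apply: QD.
have gB b v : g (phi b *: v) = phi b *: g v.
  by apply: g_uniq; rewrite hB -scalerBr; apply: QZ.
pose rmx (v : 'rV[A]_n) (a : A) : 'rV[A]_n := row_ract v a.
have gA v a : g (rmx v a) = ract (g v) a.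
  apply: g_uniq; rewrite hA.
  suff -> : rmx v a - rmx (h (g v)) a = rmx (v - h (g v)) a by apply: QM.
  by apply/rowP => i; rewrite !mxE mulrBl.
pose e i : 'rV[A]_n := delta_mx 0 i.
have e_inv i : g (e i) \in invb.
  apply/asboolP => b; rewrite -gB -gA; congr g; apply/rowP => j.
  by rewrite !mxE; case: (_ && _); rewrite ?mulr1 ?mul1r ?mulr0 ?mul0r.
have beta_add i : zmod_morphism (fun x => h (aatens x 1) 0 i).
  move=> x y; suff -> : aatens (x - y) 1 = aatens x 1 - aatens y 1.
    by rewrite raddfB !mxE.
  exact: tensBl.
pose beta0 i : {additive A -> A} := HB.pack (fun x => h (aatens x 1) 0 i)
  (GRing.isZmodMorphism.Build A A (fun x => h (aatens x 1) 0 i) (beta_add i)).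
have beta_l i b a : beta0 i (phi b * a) = phi b * beta0 i a.
  by rewrite /beta0 /= -scale_aatens hB mxE.
have beta_r i a b : beta0 i (a * phi b) = beta0 i a * phi b.
  rewrite /beta0 /= aatensM mulr1 -[phi b]mul1r -ract_aatens hA mxE.
  by rewrite mul1r.
suff qP x y : aatens x y =
    \sum_i ract (MkT (e_inv i)) (BimodEnd (beta_l i) (beta_r i) x * y).
  by exists (Quasibase qP).
rewrite /=.
have gs (F : 'I_n -> 'rV[A]_n) : g (\sum_i F i) = \sum_i g (F i).
  elim/big_rec2: _ => [|i u v _ <-]; last by rewrite gD.
  by apply: (addIr (g 0)); rewrite -gD !add0r.
under eq_bigr do rewrite -gA.
rewrite -gs -{1}[y]mul1r -ract_aatens -[LHS]gh hA; congr g.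
apply/rowP => j; rewrite summxE !mxE (bigD1 j) //= big1.
  by rewrite addr0 !mxE !eqxx mul1r.
by move=> i /negPf ij; rewrite !mxE eq_sym ij andbF mul0r.
Qed.

Definition S_ev (s : bimodEnd) (t : AA) : A := aalift (fun x y => s x * y) t.
HB.instance Definition _ (s : bimodEnd) := GRing.Additive.copy (S_ev s)
  (aalift (fun x y => s x * y)).
Lemma S_evE (s : bimodEnd) x y : S_ev s (aatens x y) = s x * y.
Proof.
apply: (aalift_aatens (f := fun x y => s x * y)); split=> *.
- by rewrite raddfD mulrDl.
- by rewrite mulrDr.
- by rewrite S_br mulrA.
Qed.
Lemma S_ev_bl (s : bimodEnd) b t : S_ev s (phi b *: t) = phi b * S_ev s t.
Proof.
elim/AA_ind: t => [|x y|t u ht hu]; first by rewrite scaler0 raddf0 mulr0.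
  by rewrite scale_aatens !S_evE S_bl mulrA.
by rewrite scalerDr [LHS]raddfD /= ht hu -mulrDr [S_ev s (t + u)]raddfD.
Qed.
Lemma S_ev_ract (s : bimodEnd) t a : S_ev s (ract t a) = S_ev s t * a.
Proof.
elim/AA_ind: t => [|x y|t u ht hu]; first by rewrite ract0 raddf0 mul0r.
  by rewrite ract_aatens !S_evE mulrA.
by rewrite ractDl [LHS]raddfD /= ht hu -mulrDl [S_ev s (t + u)]raddfD.
Qed.
Fact S_ev_centr_subproof (s : bimodEnd) (t : Tring) b :
  S_ev s t * phi b = phi b * S_ev s t.
Proof. by rewrite -S_ev_ract -T_inv S_ev_bl. Qed.
Definition S_ev_centr (s : bimodEnd) (t : Tring) : centr :=
  Centr (S_ev_centr_subproof s t).

Lemma qb_expand (q : quasibase) t :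
  t = \sum_i ract (qb_t q i) (S_ev (qb_beta q i) t).
Proof.
elim/AA_ind: t => [|x y|t u ht hu].
- rewrite big1 // => i _; rewrite raddf0.
  by apply: (addIr (ract (qb_t q i) 0)); rewrite -ractDr !add0r.
- by rewrite {1}(qbP q); apply: eq_bigr => i _; rewrite S_evE.
rewrite {1}ht {1}hu -big_split; apply: eq_bigr => i _.
by rewrite [S_ev _ (t + u)]raddfD ractDr.
Qed.

Lemma qb_expandT (q : quasibase) (t : Tring) :
  t = \sum_i T_ract (qb_t q i) (S_ev_centr (qb_beta q i) t).
Proof.
apply: T_inj; rewrite {1}(qb_expand q t).
by elim/big_rec2: _ => // i x y _ ->.
Qed.

Lemma qb_sum (q : quasibase) (Z : zmodType) (H : {additive AA -> Z}) x :
  \sum_i H (ract (qb_t q i) (qb_beta q i x)) = H (aatens x 1).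
Proof. by rewrite (qbP q) raddf_sum; under [RHS]eq_bigr do rewrite mulr1. Qed.

Definition TT : Type := tensor T_ract T_lact.
HB.instance Definition _ := GRing.Zmodule.on TT.
Definition ttens (t u : Tring) : TT := tens T_ract T_lact t u.

Definition coprod_of (q : quasibase) (u : Tring) : TT :=
  \sum_i ttens (qb_t q i) (S_act (qb_beta q i) u).

Theorem coprod_of_indep (q q' : quasibase) (u : Tring) :
  coprod_of q u = coprod_of q' u.
Proof.
rewrite /coprod_of.
under eq_bigr => i _ do
  rewrite {1}(qb_expandT q' (qb_t q i)) /ttens tens_suml.
rewrite exchange_big; apply: eq_bigr => j _.
under eq_bigr => i _ do rewrite tensM.
rewrite -raddf_sum; congr tens; apply: T_inj.
pose s' := qb_beta q' j.
transitivity (\sum_i S_ev s' (qb_t q i) *: (S_app (qb_beta q i) u)).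
  by elim/big_rec2: _ => // i x y _ <-.
rewrite -[RHS]/(S_app s' u).
elim/AA_ind: (u : AA) => [|x y|v w hv hw].
- by rewrite raddf0 big1 // => i _; rewrite raddf0 scaler0.
- under eq_bigr => i _ do rewrite S_appE scale_aatens -S_ev_ract.
  rewrite /aatens /btens -tens_suml (qb_sum q (S_ev s')).
  by rewrite /= S_evE mulr1 S_appE.
- under eq_bigr => i _ do rewrite raddfD scalerDr.
  by rewrite big_split /= hv hw raddfD.
Qed.

Lemma coprod_ofD (q : quasibase) u v :
  coprod_of q (u + v) = coprod_of q u + coprod_of q v.
Proof.
rewrite /coprod_of -big_split; apply: eq_bigr => i _.
rewrite -[RHS]tensDr; congr tens; apply: T_inj.
exact: (raddfD (S_app _)).
Qed.

Definition D2_quasibase (D2 : left_depth_two) : quasibase :=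
  sval (cid (left_depth_two_quasibase D2)).

(* By coprodE the chosen quasibase is irrelevant. *)
Definition coprod (D2 : left_depth_two) (u : Tring) : TT :=
  coprod_of (D2_quasibase D2) u.

Lemma coprodE (D2 : left_depth_two) (q : quasibase) u :
  coprod D2 u = \sum_i ttens (qb_t q i) (S_act (qb_beta q i) u).
Proof. exact: coprod_of_indep. Qed.

Section Smash.
Variables (D2 : left_depth_two) (M : lmodType A).

(* E = End(_B M), a left R-module by E_lact, with f <| t = E_ract f t. *)
Definition endB : Type := linEnd (restr M).
HB.instance Definition _ := GRing.PzRing.on endB.

Lemma E_addE (f : endB) (m n : M) : f (m + n : M) = (f m : M) + (f n : M).
Proof. exact: (@raddfD (restr M) (restr M) f m n). Qed.
Lemma E_phi (f : endB) b (m : M) : f (phi b *: m : M) = phi b *: (f m : M).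
Proof. by have := linEnd_linear f b m 0; rewrite (raddf0 f) !addr0. Qed.

Fact E_lact_subproof (r : centr) (f : endB) :
  (fun m : restr M => (r : A) *: (f m : M) : restr M) \in @linearb B (restr M).
Proof.
apply/asboolP => b m n; rewrite linearP.
rewrite [LHS]scalerDr; congr (_ + _).
by rewrite [LHS]scalerA centrP -[LHS]scalerA.
Qed.
Definition E_lact (r : centr) (f : endB) : endB := LinEnd (E_lact_subproof r f).

(* t^1 f(t^2 m) *)
Definition E_ev (f : endB) (t : AA) (m : M) : M :=
  aalift (fun x y => x *: (f (y *: m) : M)) t.

Lemma E_evE f x y m : E_ev f (aatens x y) m = x *: (f (y *: m) : M).
Proof.
apply: (aalift_aatens (f := fun x y => x *: (f (y *: m) : M))); split=> *.
- by rewrite scalerDl.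
- by rewrite scalerDl E_addE scalerDr.
- by rewrite -!scalerA E_phi.
Qed.
Lemma E_ev0 f m : E_ev f 0 m = 0. Proof. exact: raddf0. Qed.
Lemma E_evDt f s t m : E_ev f (s + t) m = E_ev f s m + E_ev f t m.
Proof. exact: raddfD. Qed.
Lemma E_evDm f t m n : E_ev f t (m + n) = E_ev f t m + E_ev f t n.
Proof.
elim/AA_ind: t => [|x y|s t hs ht]; first by rewrite !E_ev0 addr0.
  by rewrite !E_evE scalerDr E_addE scalerDr.
by rewrite !E_evDt hs ht addrACA.
Qed.
Lemma E_ev_ract f t a m : E_ev f (ract t a) m = E_ev f t (a *: m).
Proof.
elim/AA_ind: t => [|x y|s t hs ht]; first by rewrite ract0 !E_ev0.
  by rewrite ract_aatens !E_evE scalerA.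
by rewrite ractDl !E_evDt hs ht.
Qed.
Lemma E_ev_scale f t a m : E_ev f (a *: t) m = a *: E_ev f t m.
Proof.
elim/AA_ind: t => [|x y|s t hs ht]; first by rewrite scaler0 !E_ev0 scaler0.
  by rewrite scale_aatens !E_evE scalerA.
by rewrite scalerDr !E_evDt scalerDr hs ht.
Qed.
Fact E_ract_subproof (f : endB) (t : Tring) :
  (E_ev f t : restr M -> restr M) \in @linearb B (restr M).
Proof.
apply/asboolP => b m n; rewrite [LHS]E_evDm; congr (_ + _).
by rewrite -[LHS]E_ev_ract -T_inv E_ev_scale.
Qed.
Definition E_ract (f : endB) (t : Tring) : endB := LinEnd (E_ract_subproof f t).

(* T (x)_R E *)
Definition TE : Type := tensor T_ract E_lact.
HB.instance Definition _ := GRing.Zmodule.on TE.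
Definition stens (t : Tring) (f : endB) : TE := tens T_ract E_lact t f.

Definition smash_mul (x y : TE) : TE :=
  tlift (fun t f =>
    tlift (fun u g =>
      tlift (fun u1 u2 => stens (t * u1) (E_ract f u2 * g)) (coprod D2 u)) y) x.

Definition smash_one : TE := stens 1 1.

Let q := D2_quasibase D2.
Let be (i : 'I_(qb_size q)) := qb_beta q i.
Let tt (i : 'I_(qb_size q)) := qb_t q i.

Let coord (k : 'I_(qb_size q)) : TE -> endB :=
  tlift (fun w f => E_lact (S_ev_centr (be k) w) f).

Let coordE k w f m : coord k (stens w f) m = S_ev (be k) w *: (f m : M).
Proof.
rewrite /coord tlift_tens //; split=> [v v' g|v g g'|v r g]; apply: linEndP => n.
- change (S_ev (be k) (v + v' : Tring) *: (g n : M)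
    = S_ev (be k) v *: (g n : M) + S_ev (be k) v' *: (g n : M)).
  by rewrite T_addE raddfD scalerDl.
- exact: (@scalerDr _ M).
- by rewrite /= S_ev_ract scalerA.
Qed.
Let coordD k x y m : coord k (x + y) m = coord k x m + coord k y m.
Proof. by rewrite /coord raddfD. Qed.
Let coord_sum k (J : Type) (r : seq J) (F : J -> TE) m :
  coord k (\sum_(j <- r) F j) m = \sum_(j <- r) coord k (F j) m.
Proof. by rewrite /coord raddf_sum linEnd_sumE. Qed.

Lemma TE_ind (P : TE -> Prop) :
  P 0 -> (forall x y, P (stens x y)) -> (forall s t, P s -> P t -> P (s + t)) ->
  forall t, P t.
Proof. exact: tensor_ind. Qed.

Lemma stensDl t t' f : stens (t + t') f = stens t f + stens t' f.
Proof. exact: tensDl. Qed.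
Lemma stensDr t f f' : stens t (f + f') = stens t f + stens t f'.
Proof. exact: tensDr. Qed.
Lemma stensM t r f : stens (T_ract t r) f = stens t (E_lact r f).
Proof. exact: tensM. Qed.

Let smash_expand x : x = \sum_k stens (tt k) (coord k x).
Proof.
elim/TE_ind: x => [|w f|x y hx hy].
- by rewrite big1 // => k _; rewrite /coord raddf0; exact: raddf0.
- rewrite {1}(qb_expandT q w) /stens tens_suml; apply: eq_bigr => k _.
  by rewrite tensM; congr tens; apply: linEndP => m; rewrite coordE.
rewrite {1}hx {1}hy -big_split; apply: eq_bigr => k _.
have -> : coord k (x + y) = coord k x + coord k y by rewrite /coord raddfD.
by rewrite stensDr.
Qed.
Let smash_ext x y : (forall k m, coord k x m = coord k y m) -> x = y.
Proof.
move=> xy; rewrite (smash_expand x) (smash_expand y).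
by apply: eq_bigr => k _; congr stens; apply: linEndP => m; apply: xy.
Qed.

Let Phi k (t : AA) (f : endB) (n : M) (u : AA) : M :=
  aalift (fun x y => S_ev (be k) (x *: t) *: (f (y *: n) : M)) u.
Let PhiE k (t : Tring) f n x y :
  Phi k t f n (aatens x y) = S_ev (be k) (x *: (t : AA)) *: (f (y *: n) : M).
Proof.
apply: (aalift_aatens
  (f := fun x y => S_ev (be k) (x *: (t : AA)) *: (f (y *: n) : M))).
split=> [a a' c|a c c'|a b c].
- by rewrite scalerDl raddfD scalerDl.
- by rewrite scalerDl E_addE scalerDr.
- by rewrite -!scalerA T_inv -ract_scale S_ev_ract -scalerA E_phi.
Qed.
Let Phi0 k t f n : Phi k t f n 0 = 0. Proof. exact: raddf0. Qed.
Let PhiD k t f n u v : Phi k t f n (u + v) = Phi k t f n u + Phi k t f n v.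
Proof. exact: raddfD. Qed.
Let Phi_sum k t f n (J : Type) (r : seq J) (F : J -> AA) :
  Phi k t f n (\sum_(j <- r) F j) = \sum_(j <- r) Phi k t f n (F j).
Proof. exact: raddf_sum. Qed.
Let Phi_ract k (t : Tring) f n u a : Phi k t f n (ract u a) = Phi k t f (a *: n) u.
Proof.
elim/AA_ind: u => [|x y|u v hu hv]; first by rewrite ract0 !Phi0.
  by rewrite ract_aatens !PhiE scalerA.
by rewrite ractDl !PhiD hu hv.
Qed.
Let PhiDn k (t : Tring) f n n' u :
  Phi k t f (n + n') u = Phi k t f n u + Phi k t f n' u.
Proof.
elim/AA_ind: u => [|x y|u v hu hv]; first by rewrite !Phi0 addr0.
  by rewrite !PhiE scalerDr E_addE scalerDr.
by rewrite !PhiD hu hv addrACA.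
Qed.
Let PhiDt k (t t' : Tring) f n u :
  Phi k (t + t' : Tring) f n u = Phi k t f n u + Phi k t' f n u.
Proof.
elim/AA_ind: u => [|x y|u v hu hv]; first by rewrite !Phi0 addr0.
  by rewrite !PhiE -scalerDl T_addE scalerDr [S_ev _ (_ + _)]raddfD.
by rewrite !PhiD hu hv addrACA.
Qed.
Let PhiDf k (t : Tring) (f f' : endB) n u :
  Phi k t (f + f') n u = Phi k t f n u + Phi k t f' n u.
Proof.
elim/AA_ind: u => [|x y|u v hu hv]; first by rewrite !Phi0 addr0.
  by rewrite !PhiE -scalerDr.
by rewrite !PhiD hu hv addrACA.
Qed.
Let PhiM k (t : Tring) (r : centr) (f : endB) n u :
  Phi k (T_ract t r) f n u = Phi k t (E_lact r f) n u.
Proof.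
elim/AA_ind: u => [|x y|u v hu hv]; first by rewrite !Phi0.
  by rewrite !PhiE -ract_scale S_ev_ract -scalerA.
by rewrite !PhiD hu hv.
Qed.

Let tsum (Z : zmodType) (H : AA -> Z) (x : A) :
  (forall u v, H (u + v) = H u + H v) ->
  \sum_i H (ract (tt i) (be i x)) = H (aatens x 1).
Proof.
move=> HD.
have H0 : H 0 = 0 by apply: (addIr (H 0)); rewrite -HD !add0r.
rewrite (qbP q); under [X in _ = H X]eq_bigr do rewrite mulr1.
by elim/big_rec2: _ => // i a u _ ->; rewrite HD.
Qed.

Let smash_p t f u g : TE :=
  \sum_i stens (t * tt i) (E_ract f (S_act (be i) u) * g).

Let coord_p k t f u g m : coord k (smash_p t f u g) m = Phi k t f (g m) u.
Proof.
rewrite /smash_p coord_sum.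
under eq_bigr => i _ do rewrite coordE.
rewrite -[LHS]/(\sum_i S_ev (be k) (T_sand t (tt i)) *:
   E_ev f (S_app (be i) u) (g m)).
elim/AA_ind: (u : AA) => [|x y|v w hv hw].
- by rewrite Phi0 big1 // => i _; rewrite raddf0 E_ev0 scaler0.
- under eq_bigr => i _ do
    rewrite S_appE E_evE scalerA -S_ev_ract -T_sand_ract.
  rewrite -scaler_suml PhiE.
  rewrite (tsum (H := fun v => S_ev (be k) (T_sand t v))) => [|a b].
    by rewrite T_sandE ract1.
  by rewrite !raddfD.
- under eq_bigr => i _ do rewrite raddfD E_evDt scalerDr.
  by rewrite big_split /= hv hw PhiD.
Qed.

Let smash_pE t f u g :
  tlift (fun u1 u2 => stens (t * u1) (E_ract f u2 * g)) (coprod D2 u)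
  = smash_p t f u g.
Proof.
rewrite raddf_sum; apply: eq_bigr => i _.
apply: (tlift_tens (f := fun u1 u2 => stens (t * u1) (E_ract f u2 * g))).
split=> [v v' w|v w w'|v r w].
- by rewrite mulrDr stensDl.
- rewrite -stensDr -mulrDl; congr (stens _ (_ * _)).
  by apply: linEndP => m; exact: E_evDt.
- have -> : t * T_ract v r = T_ract (t * v) r.
    by apply: T_inj; exact: T_sand_ract.
  rewrite stensM; congr stens; apply: linEndP => m.
  by symmetry; exact: E_ev_scale.
Qed.

Let smash_q t f (y : TE) : TE :=
  tlift (ra := T_ract) (la := E_lact) (fun u g => smash_p t f u g) y.

Let smash_qE t f u g : smash_q t f (stens u g) = smash_p t f u g.
Proof.
apply: tlift_tens; split=> [v v' h|v h h'|v r h]; apply: smash_ext => k m.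
- by rewrite coordD !coord_p PhiD.
- by rewrite coordD !coord_p PhiDn.
- by rewrite !coord_p Phi_ract.
Qed.
Let smash_q0 t f : smash_q t f 0 = 0. Proof. exact: raddf0. Qed.
Let smash_qD t f x y : smash_q t f (x + y) = smash_q t f x + smash_q t f y.
Proof. exact: raddfD. Qed.

Let smash_mul_q t f y : smash_mul (stens t f) y = smash_q t f y.
Proof.
have e : (fun t f => tlift (ra := T_ract) (la := E_lact) (fun u g =>
    tlift (fun u1 u2 => stens (t * u1) (E_ract f u2 * g)) (coprod D2 u)) y)
    = (fun t f => smash_q t f y).
  apply/funext => v; apply/funext => h; congr (tlift _ _).
  by apply/funext => u; apply/funext => g; rewrite smash_pE.
rewrite /smash_mul e.
apply: (tlift_tens (f := fun t f => smash_q t f y)).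
split=> [v v' h|v h h'|v r h]; elim/TE_ind: y {e} => [|u g|x y hx hy].
- by rewrite !smash_q0 addr0.
- by apply: smash_ext => k m; rewrite !smash_qE coordD !coord_p PhiDt.
- by rewrite !smash_qD hx hy addrACA.
- by rewrite !smash_q0 addr0.
- by apply: smash_ext => k m; rewrite !smash_qE coordD !coord_p PhiDf.
- by rewrite !smash_qD hx hy addrACA.
- by rewrite !smash_q0.
- by apply: smash_ext => k m; rewrite !smash_qE !coord_p PhiM.
- by rewrite !smash_qD hx hy.
Qed.

Lemma smash_mul_stens t f u g :
  smash_mul (stens t f) (stens u g) =
  tlift (fun u1 u2 => stens (t * u1) (E_ract f u2 * g)) (coprod D2 u).
Proof. by rewrite smash_mul_q smash_qE smash_pE. Qed.

Let smash_mul_p t f u g : smash_mul (stens t f) (stens u g) = smash_p t f u g.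
Proof. by rewrite smash_mul_q smash_qE. Qed.

Let smash_mul0 y : smash_mul 0 y = 0. Proof. exact: raddf0. Qed.
Fact smash_mulDl : left_distributive smash_mul +%R.
Proof. by move=> x y z; rewrite /smash_mul raddfD. Qed.
Fact smash_mulDr : right_distributive smash_mul +%R.
Proof.
move=> x y z; elim/TE_ind: x => [|t f|x x' hx hx'].
- by rewrite !smash_mul0 addr0.
- by rewrite !smash_mul_q smash_qD.
- by rewrite !smash_mulDl hx hx' addrACA.
Qed.
Let smash_mulr0 y : smash_mul y 0 = 0.
Proof. by apply: (addIr (smash_mul y 0)); rewrite -smash_mulDr !add0r. Qed.
Let smash_mul_suml (J : Type) (r : seq J) (F : J -> TE) y :
  smash_mul (\sum_(j <- r) F j) y = \sum_(j <- r) smash_mul (F j) y.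
Proof. exact: raddf_sum. Qed.
Let smash_mul_sumr (J : Type) (r : seq J) (F : J -> TE) y :
  smash_mul y (\sum_(j <- r) F j) = \sum_(j <- r) smash_mul y (F j).
Proof.
elim/big_rec2: _ => [|j x z _ <-]; first exact: smash_mulr0.
by rewrite smash_mulDr.
Qed.

Fact smash_mul1 : left_id smash_one smash_mul.
Proof.
elim/TE_ind => [|u g|x y hx hy]; first exact: smash_mulr0.
  rewrite smash_mul_p; apply: smash_ext => k m; rewrite coord_p coordE.
  elim/AA_ind: (u : AA) => [|x y|v w hv hw].
  - by rewrite Phi0 raddf0 scale0r.
  - by rewrite PhiE T_oneE scale_aatens !S_evE !mulr1 scalerA.
  - by rewrite PhiD hv hw raddfD scalerDl.
by rewrite smash_mulDr hx hy.
Qed.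
Fact smash_mulr1 : right_id smash_one smash_mul.
Proof.
elim/TE_ind => [|t f|x y hx hy]; first exact: smash_mul0.
  rewrite smash_mul_p; apply: smash_ext => k m; rewrite coord_p coordE.
  by rewrite T_oneE PhiE !scale1r.
by rewrite smash_mulDl hx hy.
Qed.

Let smash_mulA_stens t f u g v h :
  smash_mul (stens t f) (smash_mul (stens u g) (stens v h)) =
  smash_mul (smash_mul (stens t f) (stens u g)) (stens v h).
Proof.
apply: smash_ext => k m.
rewrite [in RHS]smash_mul_p [in RHS]/smash_p smash_mul_suml coord_sum.
under [RHS]eq_bigr => i _ do rewrite smash_mul_p coord_p.
rewrite smash_mul_p [in LHS]/smash_p smash_mul_sumr coord_sum.
under [LHS]eq_bigr => i _ do rewrite smash_mul_p coord_p.
pose n : M := h m.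
rewrite -[LHS]/(\sum_i Phi k t f (E_ev g (S_app (be i) v) n) (T_sand u (tt i))).
rewrite -[RHS]/(\sum_i Phi k (T_sand t (tt i))
   (E_ract f (S_act (be i) u) * g) n v).
elim/AA_ind: (v : AA) => [|x y|w w' hw hw'].
- rewrite !big1 // => i _; rewrite raddf0 E_ev0; set z := Phi _ _ _ _ _.
  by apply: (addIr z); rewrite /z -PhiDn !add0r.
- under eq_bigr => i _ do rewrite S_appE E_evE -Phi_ract -T_sand_ract.
  rewrite (tsum (H := fun w => Phi k t f (g (y *: n) : M) (T_sand u w)));
    last by move=> a b; rewrite raddfD PhiD.
  rewrite T_sandE ract1.
  under [RHS]eq_bigr => i _ do rewrite (PhiE k (t * tt i)).
  rewrite -[RHS]/(\sum_i S_ev (be k) (x *: T_sand t (tt i)) *: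
    E_ev f (S_app (be i) u) (g (y *: n))).
  elim/AA_ind: (u : AA) => [|a c|w w' hw hw'].
  + by rewrite scaler0 Phi0 big1 // => i _; rewrite raddf0 E_ev0 scaler0.
  + rewrite scale_aatens PhiE.
    under [RHS]eq_bigr => i _ do
      rewrite S_appE E_evE scalerA -S_ev_ract ract_scale -T_sand_ract.
    rewrite -scaler_suml.
    rewrite (tsum (H := fun w => S_ev (be k) (x *: T_sand t w)));
      last by move=> d e; rewrite !raddfD.
    by rewrite T_sandE ract1 scalerA.
  + rewrite scalerDr PhiD hw hw' -big_split; apply: eq_bigr => i _.
    by rewrite raddfD E_evDt scalerDr.
- under eq_bigr => i _ do rewrite raddfD E_evDt (PhiDn k t).
  rewrite big_split /= hw hw' -big_split; apply: eq_bigr => i _.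
  by rewrite PhiD.
Qed.

Fact smash_mulA : associative smash_mul.
Proof.
move=> x y z; elim/TE_ind: x => [|t f|x x' hx hx'].
- by rewrite !smash_mul0.
- elim/TE_ind: y => [|u g|y y' hy hy'].
  + by rewrite !(smash_mulr0, smash_mul0).
  + elim/TE_ind: z => [|v h|z z' hz hz'].
    * by rewrite !smash_mulr0.
    * exact: smash_mulA_stens.
    * by rewrite !smash_mulDr hz hz'.
  + by rewrite smash_mulDl !smash_mulDr hy hy' smash_mulDl.
- by rewrite !smash_mulDl hx hx'.
Qed.

End Smash.

(* The smash product ring; D2 enters through the coproduct. *)
Definition smash (D2 : left_depth_two) (M : lmodType A) : Type := TE M.
HB.instance Definition _ D2 M := GRing.Zmodule.on (smash D2 M).
HB.instance Definition _ D2 M := GRing.Zmodule_isPzRing.Build (smash D2 M)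
  (@smash_mulA D2 M) (@smash_mul1 D2 M) (@smash_mulr1 D2 M)
  (@smash_mulDl D2 M) (@smash_mulDr D2 M).

Lemma smash_mulE D2 M (t u : Tring) (f g : endB M) :
  (stens t f : smash D2 M) * (stens u g : smash D2 M) =
  tlift (fun u1 u2 => stens (t * u1) (E_ract f u2 * g) : smash D2 M)
        (coprod D2 u).
Proof. exact: smash_mul_stens. Qed.

Lemma smash_oneE D2 M : 1 = stens 1 1 :> smash D2 M.
Proof. by []. Qed.

(* a t^1 (x) t^2 m *)
Definition sandwich (M : lmodType A) (a : A) (t : AA) (m : M) : tensB M :=
  aalift (fun x y => btens (a * x) (y *: m)) t.

Lemma sandwichE (M : lmodType A) (a x y : A) (m : M) :
  sandwich a (aatens x y) m = btens (a * x) (y *: m).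
Proof.
apply: (aalift_aatens (f := fun x y => btens (a * x) (y *: m))); split=> *.
- by rewrite mulrDr btensDl.
- by rewrite scalerDl btensDr.
- by rewrite mulrA btensM scalerA.
Qed.

End Extension.

(* Main.v *)
Require Import Defs.
From HB Require Import structures.
From mathcomp Require Import all_boot all_algebra.
From mathcomp Require Import boolp.

Set Implicit Arguments.
Unset Strict Implicit.
Unset Printing Implicit Defensive.

Import GRing.Theory.
Local Open Scope ring_scope.

(** Why [Psi] is an isomorphism. Write a left depth two quasibase as
    x (x) y = sum_i t_i beta_i(x) y. It has two consequences.

    First, [Psi] is multiplicative: the coproduct turns the product of t (x) f
    and u (x) g into
      sum_i t t_i (x) (f <| (beta_i(u^1) (x) u^2)) g,
    which [Psi] evaluates at a (x) m to
      sum_i a t_i^1 t^1 (x) t^2 t_i^2 beta_i(u^1) f(u^2 g(m)).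
    As sum_i t_i beta_i(u^1) = u^1 (x) 1, this is a u^1 t^1 (x) t^2 f(u^2 g(m)),
    the value of the composite [Psi (t (x) f) o Psi (u (x) g)]. This is
    [smash_act_mul_stens].

    Second, [Psi] has an explicit inverse. For F in End(_A A (x)_B M), let
    F_i(m) be the image of F(1 (x) m) under the contraction
    a (x) n |-> beta_i(a) n. Then F_i is B-linear, and the inverse is
    F |-> sum_i t_i (x) F_i. In one direction, the quasibase identity gives
    sum_i a t_i^1 (x) t_i^2 beta_i(x) n = a x (x) n, which rebuilds a F(1 (x) m)
    ([smash_coactK]). In the other, the contraction of t^1 (x) t^2 f(m) is
    beta_i(t^1) t^2 f(m), where beta_i(t^1) t^2 lies in R; moving this scalar
    across the tensor product over R leaves the expansion of t in the
    quasibase ([smash_actK]). *)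

Section SmashAction.
Variables (A B : pzRingType) (phi : {rmorphism B -> A}) (M : lmodType A).
Implicit Types (a : A) (b : B) (m n : M) (u v w : AA phi) (t : Tring phi).
Implicit Types (f g : endB phi M) (s : bimodEnd phi) (z : tensB phi M).

(** * The map sending m to a t^1 (x) t^2 m *)

Lemma sandwich0 a m : sandwich a (0 : AA phi) m = 0.
Proof. exact: raddf0. Qed.

Lemma sandwichDm a u v m :
  sandwich a (u + v) m = sandwich a u m + sandwich a v m.
Proof. exact: raddfD. Qed.

Lemma sandwich_sum (J : Type) (r : seq J) (F : J -> AA phi) a m :
  sandwich a (\sum_(j <- r) F j) m = \sum_(j <- r) sandwich a (F j) m.
Proof. exact: raddf_sum. Qed.

Lemma sandwichDr a u m n :
  sandwich a u (m + n) = sandwich a u m + sandwich a u n.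
Proof.
elim/AA_ind: u => [|x y|v w hv hw]; first by rewrite !sandwich0 addr0.
  by rewrite !sandwichE scalerDr btensDr.
by rewrite !sandwichDm hv hw addrACA.
Qed.

Lemma sandwichr0 a u : sandwich a u (0 : M) = 0.
Proof. by apply: (addIr (sandwich a u 0)); rewrite -sandwichDr !add0r. Qed.

Lemma scale_sandwich c a u m : c *: sandwich a u m = sandwich (c * a) u m.
Proof.
elim/AA_ind: u => [|x y|v w hv hw]; first by rewrite !sandwich0 scaler0.
  by rewrite !sandwichE scale_btens mulrA.
by rewrite !sandwichDm scalerDr hv hw.
Qed.

Lemma sandwichDl a c u m :
  sandwich (a + c) u m = sandwich a u m + sandwich c u m.
Proof.
elim/AA_ind: u => [|x y|v w hv hw]; first by rewrite !sandwich0 addr0.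
  by rewrite !sandwichE mulrDl btensDl.
by rewrite !sandwichDm hv hw addrACA.
Qed.

Lemma sandwich_scale a c u m : sandwich a (c *: u) m = sandwich (a * c) u m.
Proof.
elim/AA_ind: u => [|x y|v w hv hw]; first by rewrite scaler0 !sandwich0.
  by rewrite scale_aatens !sandwichE mulrA.
by rewrite scalerDr !sandwichDm hv hw.
Qed.

Lemma sandwich_ract a u c m : sandwich a (ract u c) m = sandwich a u (c *: m).
Proof.
elim/AA_ind: u => [|x y|v w hv hw]; first by rewrite ract0 !sandwich0.
  by rewrite ract_aatens !sandwichE scalerA.
by rewrite ractDl !sandwichDm hv hw.
Qed.

(** * The action of T (x)_R E on A (x)_B M *)

Definition stens_fun t f : tensB phi M -> tensB phi M :=
  blift (fun a m => sandwich a t (f m : M)).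

(** B-centrality of t is what makes a (x) m |-> a t^1 (x) t^2 f(m) balanced:
    b t^1 (x) t^2 f(m) = t^1 (x) t^2 b f(m) = t^1 (x) t^2 f(b m). *)
Lemma stens_funE t f a m :
  stens_fun t f (btens phi a m) = sandwich a t (f m : M).
Proof.
apply: (blift_btens (f := fun a m => sandwich a t (f m : M))).
split=> [x x' y|x y y'|x b y].
- exact: sandwichDl.
- by rewrite E_addE sandwichDr.
- by rewrite E_phi -sandwich_ract -T_inv sandwich_scale.
Qed.

Lemma stens_fun0 t f : stens_fun t f 0 = 0.
Proof. exact: raddf0. Qed.

Lemma stens_funD t f z z' :
  stens_fun t f (z + z') = stens_fun t f z + stens_fun t f z'.
Proof. exact: raddfD. Qed.

Fact stens_fun_linear t f : stens_fun t f \in @linearb A (tensB phi M).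
Proof.
apply/asboolP => c z z'; rewrite stens_funD; congr (_ + _).
elim/tensB_ind: z => [|x m|y y' hy hy'].
- by rewrite scaler0 stens_fun0 scaler0.
- by rewrite scale_btens !stens_funE scale_sandwich.
- by rewrite scalerDr !stens_funD scalerDr hy hy'.
Qed.

Definition stens_end t f : linEnd (tensB phi M) :=
  LinEnd (stens_fun_linear t f).

Lemma tensB_linEndP (F G : linEnd (tensB phi M)) :
  (forall a m, F (btens phi a m) = G (btens phi a m)) -> F = G.
Proof.
move=> FG; apply: linEndP; elim/tensB_ind => [|x m|y y' hy hy'].
- by rewrite (raddf0 F) (raddf0 G).
- exact: FG.
- by rewrite (raddfD F) (raddfD G) /= hy hy'.
Qed.

Definition smash_act (x : TE phi M) : linEnd (tensB phi M) := tlift stens_end x.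

Lemma smash_act_stens t f : smash_act (stens t f) = stens_end t f.
Proof.
apply: tlift_tens; split=> [t1 t2 g|t1 g g'|t1 r g];
  apply: tensB_linEndP => a m; rewrite ?linEnd_addE /= !stens_funE.
- by rewrite T_addE sandwichDm.
- by rewrite -sandwichDr.
- by rewrite sandwich_ract.
Qed.

Lemma smash_act0 : smash_act 0 = 0.
Proof. exact: raddf0. Qed.

Lemma smash_actB : zmod_morphism smash_act.
Proof. by move=> x y; rewrite /smash_act raddfB. Qed.

Lemma smash_actD x y : smash_act (x + y) = smash_act x + smash_act y.
Proof. exact: raddfD. Qed.

Lemma smash_act_sum (J : Type) (r : seq J) (F : J -> TE phi M) :
  smash_act (\sum_(j <- r) F j) = \sum_(j <- r) smash_act (F j).
Proof. exact: raddf_sum. Qed.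

(** * Multiplicativity *)

Variables (q : quasibase phi).
Let beta (i : 'I_(qb_size q)) := qb_beta i.
Let tau (i : 'I_(qb_size q)) := qb_t i.

(** The left side is the shape in which the coproduct of u presents
    a u^1 t^1 (x) t^2 f(u^2 m): since beta_i(u^1) moves to the right end of
    t_i, the sum over i reassembles t_i beta_i(u^1) into u^1 (x) 1. *)
Lemma sandwich_mul_sum a t f u m :
  \sum_i sandwich a (T_sand t (tau i)) (E_ev f (S_app (beta i) u) m) =
  stens_fun t f (sandwich a u m).
Proof.
elim/AA_ind: u => [|x y|v w hv hw].
- rewrite sandwich0 stens_fun0 big1 // => i _.
  by rewrite raddf0 E_ev0 sandwichr0.
- rewrite sandwichE stens_funE.
  under eq_bigr => i _ do
    rewrite S_appE E_evE -sandwich_ract -T_sand_ract -[beta i x]mulr1.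
  rewrite -sandwich_sum -(raddf_sum (T_sand t)) -(qbP q) /= T_sandE ract1.
  by rewrite sandwich_scale.
- under eq_bigr => i _ do rewrite raddfD E_evDt sandwichDr.
  by rewrite big_split /= hv hw sandwichDm stens_funD.
Qed.

Lemma smash_act_mul_stens (D2 : left_depth_two phi) t f t' g :
  smash_act ((stens t f : smash D2 M) * (stens t' g : smash D2 M)) =
  stens_end t f * stens_end t' g.
Proof.
rewrite smash_mulE (coprodE D2 q) raddf_sum smash_act_sum.
apply: tensB_linEndP => a m; rewrite linEnd_sumE linEnd_mulE /= stens_funE.
rewrite -sandwich_mul_sum; apply: eq_bigr => i _.
(* The summand is balanced over R, so the lift may be evaluated on it. *)
rewrite [X in smash_act X](tlift_tens
  (f := fun u1 u2 : Tring phi => stens (t * u1) (E_ract f u2 * g))).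
  by rewrite smash_act_stens /= stens_funE.
split=> [v v' w|v w w'|v r w].
- by rewrite mulrDr stensDl.
- rewrite -stensDr -mulrDl; congr (stens _ (_ * _)).
  by apply: linEndP => n; rewrite -[RHS]E_evDt.
- have -> : t * T_ract v r = T_ract (t * v) r.
    by apply: T_inj; exact: T_sand_ract.
  rewrite stensM; congr stens; apply: linEndP => n.
  by rewrite [RHS]E_ev_scale.
Qed.

Lemma smash_act_monoid (D2 : left_depth_two phi) :
  monoid_morphism (smash_act : smash D2 M -> linEnd (tensB phi M)).
Proof.
split.
  rewrite smash_oneE smash_act_stens; apply: tensB_linEndP => a m /=.
  by rewrite stens_funE T_oneE sandwichE mulr1 scale1r.
move=> x y; elim/TE_ind: x => [|t f|x x' hx hx'].
- by rewrite (mul0r (y : smash D2 M)) smash_act0 mul0r.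
- elim/TE_ind: y => [|t' g|y y' hy hy'].
  + by rewrite (mulr0 (stens t f : smash D2 M)) smash_act0 mulr0.
  + by rewrite !smash_act_stens smash_act_mul_stens.
  + by rewrite (mulrDr (stens t f : smash D2 M)) !smash_actD hy hy' mulrDr.
- by rewrite (mulrDl (x : smash D2 M)) !smash_actD hx hx' mulrDl.
Qed.

(** * The inverse *)

(** For s = id this is the action map A (x)_B M -> M; twisting it by the
    beta_i yields the coordinates of an element of A (x)_B M. *)
Definition contract s : tensB phi M -> M := blift (fun a m => s a *: m).

Lemma contractE s a m : contract s (btens phi a m) = s a *: m.
Proof.
apply: (blift_btens (f := fun a m => s a *: m)); split=> [x x' y|x y y'|x b y].
- by rewrite raddfD scalerDl.
- by rewrite scalerDr.
- by rewrite S_br scalerA.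
Qed.

Lemma contract0 s : contract s 0 = 0.
Proof. exact: raddf0. Qed.

Lemma contractD s z z' : contract s (z + z') = contract s z + contract s z'.
Proof. exact: raddfD. Qed.

Lemma contract_scale s b z : contract s (phi b *: z) = phi b *: contract s z.
Proof.
elim/tensB_ind: z => [|x m|y y' hy hy'].
  by rewrite scaler0 contract0 scaler0.
  by rewrite scale_btens !contractE S_bl scalerA.
by rewrite scalerDr !contractD scalerDr hy hy'.
Qed.

Lemma contract_sandwich s u m : contract s (sandwich 1 u m) = S_ev s u *: m.
Proof.
elim/AA_ind: u => [|x y|v w hv hw].
- by rewrite sandwich0 contract0 raddf0 scale0r.
- by rewrite sandwichE contractE S_evE mul1r scalerA.
- by rewrite sandwichDm contractD hv hw raddfD scalerDl.
Qed.

(** A scalar b crosses from m to the left factor of 1 (x) m, leaves F by left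
    A-linearity, and leaves the contraction because s is left B-linear. *)
Lemma slice_linear s (F : linEnd (tensB phi M)) b m n :
  contract s (F (btens phi 1 (phi b *: m + n))) =
  phi b *: contract s (F (btens phi 1 m)) + contract s (F (btens phi 1 n)).
Proof.
rewrite btensDr -btensM mul1r -[phi b in LHS]mulr1 -scale_btens.
by rewrite linearP contractD contract_scale.
Qed.

Definition slice s (F : linEnd (tensB phi M)) : endB phi M.
Proof.
exists (fun m : restr M => contract s (F (btens phi 1 (m : M))) : restr M).
exact: (asboolT (slice_linear s F)).
Defined.

Definition smash_coact (F : linEnd (tensB phi M)) : TE phi M :=
  \sum_i stens (tau i) (slice (beta i) F).

Lemma smash_coactD F G : smash_coact (F + G) = smash_coact F + smash_coact G.
Proof.
rewrite /smash_coact -big_split; apply: eq_bigr => i _.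
rewrite -[RHS]stensDr; congr stens; apply: linEndP => m.
by rewrite -[RHS]contractD.
Qed.

(** On z = x (x) m the scalar beta_i(x) moves to the right end of t_i, and the
    quasibase identity rebuilds a x (x) m. *)
Lemma sandwich_contract a z :
  \sum_i sandwich a (tau i) (contract (beta i) z) = a *: z.
Proof.
elim/tensB_ind: z => [|x m|y y' hy hy'].
- rewrite scaler0 big1 // => i _.
  by rewrite contract0 sandwichr0.
- under eq_bigr => i _ do rewrite contractE -sandwich_ract -[beta i x]mulr1.
  by rewrite -sandwich_sum -(qbP q) sandwichE scale1r scale_btens.
- under eq_bigr => i _ do rewrite contractD sandwichDr.
  by rewrite big_split /= hy hy' scalerDr.
Qed.

Lemma smash_coactK : cancel smash_coact smash_act.
Proof.
move=> F; rewrite smash_act_sum; apply: tensB_linEndP => a m.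
rewrite linEnd_sumE.
under eq_bigr => i _ do rewrite smash_act_stens /= stens_funE.
by rewrite sandwich_contract -linearZ scale_btens mulr1.
Qed.

(** The scalar beta_i(t^1) t^2 acts on f as an element of R, so it can be moved
    onto t_i, where these scalars are the coordinates of t in the quasibase. *)
Lemma smash_actK : cancel smash_act smash_coact.
Proof.
elim/TE_ind => [|t f|x y hx hy].
- rewrite smash_act0; apply: (addIr (smash_coact 0)).
  by rewrite -smash_coactD !add0r.
- rewrite smash_act_stens [in RHS](qb_expandT q t) /stens tens_suml.
  apply: eq_bigr => i _; rewrite tensM; congr tens; apply: linEndP => m /=.
  by rewrite stens_funE contract_sandwich.
- by rewrite smash_actD smash_coactD hx hy.
Qed.

End SmashAction.

Theorem theorem4p1 (k : fieldType) (A B : pzRingType)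
    (etaA : {rmorphism k -> A}) (etaB : {rmorphism k -> B})
    (etaA_central : central etaA) (etaB_central : central etaB)
    (phi : {rmorphism B -> A}) (phi_eta : forall c, phi (etaB c) = etaA c)
    (M : lmodType A) (D2 : left_depth_two phi) :
  exists Psi : {rmorphism smash D2 M -> linEnd (tensB phi M)},
    bijective Psi /\
    forall (t : Tring phi) (f : endB phi M) (a : A) (m : M),
      Psi (stens t f) (btens phi a m) = sandwich a t (f m : M).
Proof.
have [q _] := left_depth_two_quasibase D2.
pose psi : smash D2 M -> linEnd (tensB phi M) := @smash_act A B phi M.
pose psiB := GRing.isZmodMorphism.Build _ _ psi (@smash_actB A B phi M).
pose psiM := GRing.isMonoidMorphism.Build _ _ psi (smash_act_monoid M q D2).
pose Psi : {rmorphism smash D2 M -> linEnd (tensB phi M)} :=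
  HB.pack psi psiB psiM.
exists Psi; split.
  by exists (smash_coact q); [exact: smash_actK | exact: smash_coactK].
move=> t f a m; rewrite -[LHS]/(smash_act (stens t f) (btens phi a m)).
by rewrite smash_act_stens /= stens_funE.
Qed.
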